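(* The continued fraction \[ 8+\cfrac{8}{11-\cfrac{9}{24-\cfrac{25}{36-\cfrac{49}{48-\cdots}}}}, \] i.e. with $a(0)=8$, $a(1)=11$, $a(n)=12n$ for $n\ge2$, $b(0)=8$, $b(n)=-(2n+1)^2$ for $n\ge1$, converges to $\big(\Gamma(1/4)/\Gamma(3/4)\big)^2$. Moreover, with $p(n)/q(n)$ its $n$-th convergent, as $n\to\infty$ \[ \Big(\frac{\Gamma(1/4)}{\Gamma(3/4)}\Big)^2-\frac{p(n)}{q(n)}\sim\frac{4(\Gamma(1/4)/\Gamma(3/4))^2}{(1+\sqrt2)^{4n+4}}. \]
   Context: For sequences $a(n),b(n)$, the continued fraction is $a(0)+\cfrac{b(0)}{a(1)+\cfrac{b(1)}{a(2)+\cdots}}$ and its $n$-th convergent $p(n)/q(n)$ is the truncation ending with $b(n-1)/a(n)$. *)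

(* Defs.v *)
From Stdlib Require Import Reals.
From Coquelicot Require Import Coquelicot.
Open Scope R_scope.

(* Euler's Gamma function, Gamma(s) = \int_0^\infty t^(s-1) e^(-t) dt
   (improper Riemann integral, Coquelicot's RInt_gen; meaningful for s > 0). *)
Definition Gamma (s : R) : R :=
  RInt_gen (fun t => Rpower t (s - 1) * exp (- t)) (at_right 0) (Rbar_locally p_infty).

(* Convergents of a(0) + b(0)/(a(1) + b(1)/(a(2) + ...)) via the standard
   three-term recurrences
     p(-1)=1, p(0)=a(0), q(-1)=0, q(0)=1,
     p(n)=a(n)p(n-1)+b(n-1)p(n-2),  q(n)=a(n)q(n-1)+b(n-1)q(n-2).
   cf_pq a b n = (p n, p (n-1), q n, q (n-1)). *)
Fixpoint cf_pq (a b : nat -> R) (n : nat) : R * R * R * R :=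
  match n with
  | O => (a O, 1, 1, 0)
  | S m =>
      let '(p, p', q, q') := cf_pq a b m in
      (a (S m) * p + b m * p', p, a (S m) * q + b m * q', q)
  end.

Definition cf_p (a b : nat -> R) (n : nat) : R :=
  let '(p, _, _, _) := cf_pq a b n in p.
Definition cf_q (a b : nat -> R) (n : nat) : R :=
  let '(_, _, q, _) := cf_pq a b n in q.

Definition a61 (n : nat) : R :=
  match n with
  | O => 8
  | 1%nat => 11
  | _ => 12 * INR n
  end.

Definition b61 (n : nat) : R :=
  match n with
  | O => 8
  | _ => - (2 * INR n + 1) ^ 2
  end.

(* Main.v *)
Require Import Defs.
From Stdlib Require Import Reals Lra Lia Classical_Prop.
From Coquelicot Require Import Coquelicot.
Open Scope R_scope.

(* After division by (2n+1)!! the recurrence of the convergents becomes that of the Legendre functions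
   of degree n + 1/2 at 3. Its minimal solution is an integral M(n+1) over [0, pi/2] whose first two
   values are alpha and alpha - 2 beta, with alpha and beta the lemniscate integrals of
   dt / sqrt (1 - t^4) and t^2 dt / sqrt (1 - t^4). Hence L q(n) - p(n) = (2n+1)!! (4 / beta) M(n+1)
   with L = 4 alpha / beta, and log-convexity of Gamma identifies L with (Gamma(1/4) / Gamma(3/4))^2.
   The size of M(n) comes from comparison with an integral H(n) computable from Wallis integrals;
   Wallis integrals are related to alpha beta through the integrals of t^k dt / sqrt (1 - t^4), so no
   value of alpha, beta or pi is needed. Finally the Casoratian p(n) q(n-1) - p(n-1) q(n) turns
   the asymptotics of M into those of q(n) / M(n+1) via an affine contraction. *)

(** * Integrals over a quarter period *)

Definition quarter (f : R -> R) : R := RInt f 0 (PI / 2).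

Definition cont (f : R -> R) : Prop := forall x, continuous f x.

Lemma quarter_pos : 0 <= PI / 2.
Proof. generalize PI_RGT_0; lra. Qed.

Lemma cont_ex_RInt (f : R -> R) (a b : R) : cont f -> ex_RInt f a b.
Proof. intros Hf; apply (ex_RInt_continuous (V := R_CompleteNormedModule)); intros; apply Hf. Qed.

Lemma quarter_lin (f g : R -> R) (a b : R) : cont f -> cont g ->
  quarter (fun x => a * f x + b * g x) = a * quarter f + b * quarter g.
Proof.
  intros Hf Hg; unfold quarter; apply is_RInt_unique.
  apply (is_RInt_plus (V := R_NormedModule) (fun x => a * f x) (fun x => b * g x)).
  - apply (is_RInt_scal (V := R_NormedModule) f); apply (RInt_correct (V := R_CompleteNormedModule)), cont_ex_RInt, Hf.
  - apply (is_RInt_scal (V := R_NormedModule) g); apply (RInt_correct (V := R_CompleteNormedModule)), cont_ex_RInt, Hg.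
Qed.

Lemma quarter_ext (f g : R -> R) : (forall x, f x = g x) -> quarter f = quarter g.
Proof. intros H; apply RInt_ext; auto. Qed.

Lemma quarter_scal (f : R -> R) (a : R) : cont f ->
  quarter (fun x => a * f x) = a * quarter f.
Proof.
  intros Hf; rewrite <- (Rplus_0_r (a * _)), <- (Rmult_0_l (quarter f)).
  rewrite <- quarter_lin by assumption.
  apply quarter_ext; intros; ring.
Qed.

Lemma cont_lin (f g : R -> R) (a b : R) : cont f -> cont g ->
  cont (fun x => a * f x + b * g x).
Proof.
  intros Hf Hg x.
  apply (continuous_plus (V := R_NormedModule) (fun x => a * f x) (fun x => b * g x)).
  - apply (continuous_scal_r (V := R_NormedModule) a f), Hf.
  - apply (continuous_scal_r (V := R_NormedModule) b g), Hg.
Qed.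

Lemma quarter_le (f g : R -> R) : cont f -> cont g ->
  (forall x, 0 < x < PI / 2 -> f x <= g x) -> quarter f <= quarter g.
Proof.
  intros Hf Hg H; apply RInt_le; auto using quarter_pos, cont_ex_RInt.
Qed.

Lemma quarter_derive (F f : R -> R) : (forall x, is_derive F x (f x)) -> cont f ->
  quarter f = F (PI / 2) - F 0.
Proof.
  intros HF Hf; unfold quarter; apply is_RInt_unique.
  apply (is_RInt_derive (V := R_CompleteNormedModule) F f); auto.
Qed.

(** The hypothesis [z' K = z g] restores the power lost in differentiating [z ^ n], so the formula
    has no exception at [n = 0]. When [g] and [k] are polynomials in [z] times one weight and [K]
    vanishes at both ends, integration gives a recurrence for the moments of [z]. *)
Lemma is_derive_pow_mult (z K z' k g : R -> R) (n : nat) :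
  (forall x, is_derive z x (z' x)) -> (forall x, is_derive K x (k x)) ->
  (forall x, z' x * K x = z x * g x) ->
  forall x, is_derive (fun x => z x ^ n * K x) x (z x ^ n * (INR n * g x + k x)).
Proof.
  intros Hz HK Hg x.
  replace (z x ^ n * (INR n * g x + k x))
    with (INR n * z' x * z x ^ pred n * K x + z x ^ n * k x).
  - apply (is_derive_mult (fun x => z x ^ n) K).
    + apply is_derive_pow, Hz.
    + apply HK.
    + intros; apply Rmult_comm.
  - destruct n as [|n]; [simpl; ring|].
    change (pred (S n)) with n.
    rewrite !Rmult_plus_distr_l; f_equal.
    replace (INR (S n) * z' x * z x ^ n * K x)
      with (INR (S n) * z x ^ n * (z' x * K x)) by ring.
    rewrite Hg; simpl; ring.
Qed.

Lemma one_cos_pos (x : R) : 0 < 1 + cos x ^ 2.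
Proof. generalize (pow2_ge_0 (cos x)); lra. Qed.

Lemma sin_sq (x : R) : sin x ^ 2 = 1 - cos x ^ 2.
Proof. generalize (sin2_cos2 x); unfold Rsqr; lra. Qed.

Lemma sqrt_one_cos_pos (x : R) : 0 < sqrt (1 + cos x ^ 2).
Proof. apply sqrt_lt_R0, one_cos_pos. Qed.

Lemma sqrt_one_cos_sq (x : R) : sqrt (1 + cos x ^ 2) ^ 2 = 1 + cos x ^ 2.
Proof. apply pow2_sqrt, Rlt_le, one_cos_pos. Qed.

Ltac trig_side x :=
  let C := fresh in let W := fresh in
  assert (C := one_cos_pos x); assert (W := sqrt_one_cos_pos x);
  simpl in C, W |- *; repeat split; auto; try lra.

Ltac cont_tac :=
  let x := fresh "x" in
  intro x; apply (ex_derive_continuous (V := R_NormedModule)); auto_derive; trig_side x.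

(* [z61] is the Gauss-Landen image of [(sin theta)^2 / lam], where [lam = (1 + sqrt 2)^2]: it makes
   [M61 n], up to a constant factor, the Legendre function [Q_(n-1/2)(3)], and [M61 0] the lemniscate
   integral [lemn 0]. [h61] is the derivative of the substitution [theta]. *)
Definition z61 (x : R) : R := sin x ^ 2 * cos x ^ 2 / (1 + cos x ^ 2).
Definition M61 (n : nat) : R := quarter (fun x => z61 x ^ n / sqrt (1 + cos x ^ 2)).
Definition h61 (x : R) : R := 1 + sqrt 2 / (1 + cos x ^ 2).
Definition H61 (n : nat) : R := quarter (fun x => z61 x ^ n * h61 x).
Definition wallis (k : nat) : R := quarter (fun x => cos x ^ k).
(** Under [t = cos x] this is the integral of [t^k / sqrt (1 - t^4)] over [0, 1]. *)
Definition lemn (k : nat) : R := quarter (fun x => cos x ^ k / sqrt (1 + cos x ^ 2)).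

Lemma cont_z (n : nat) : cont (fun x => z61 x ^ n / sqrt (1 + cos x ^ 2)).
Proof. unfold z61; cont_tac. Qed.
Lemma cont_zh (n : nat) : cont (fun x => z61 x ^ n * h61 x).
Proof. unfold z61, h61; cont_tac. Qed.
Lemma cont_wallis (n : nat) : cont (fun x => cos x ^ n).
Proof. cont_tac. Qed.
Lemma cont_lemn (n : nat) : cont (fun x => cos x ^ n / sqrt (1 + cos x ^ 2)).
Proof. cont_tac. Qed.

Definition dz61 (x : R) : R :=
  - 2 * sin x * cos x * (1 - 2 * cos x ^ 2 - cos x ^ 4) / (1 + cos x ^ 2) ^ 2.

Lemma is_derive_z61 (x : R) : is_derive z61 x (dz61 x).
Proof.
  unfold z61, dz61; auto_derive; [trig_side x|].
  assert (C := one_cos_pos x); assert (Sx := sin_sq x).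
  simpl in Sx; rewrite !Rmult_1_r in Sx.
  generalize (sin x) (cos x) Sx C; clear; intros s c Sx C.
  field_simplify_eq; [ring [Sx] | simpl; lra].
Qed.

(* In the variable [z61], [K] is [sqrt (z (z^2 - 6 z + 1))] up to sign. *)
Lemma M61_rec (n : nat) :
  (2 * INR n + 3) * M61 (S (S n)) = 12 * (INR n + 1) * M61 (S n) - (2 * INR n + 1) * M61 n.
Proof.
  pose (w x := sqrt (1 + cos x ^ 2)).
  pose (K x := sin x * cos x * (cos x ^ 4 + 2 * cos x ^ 2 - 1) / ((1 + cos x ^ 2) * w x)).
  (* With [P = z^3 - 6 z^2 + z] and [K^2 = P], the substitution satisfies [z' = 2 K / w]; hence
     [k = P'(z) / w] is the derivative of [K], and [g = 2 P / (z w)]. *)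
  pose (k x := (3 * z61 x ^ 2 - 12 * z61 x + 1) / w x).
  pose (g x := 2 * (z61 x ^ 2 - 6 * z61 x + 1) / w x).
  pose (f x := (2 * INR n + 3) * (z61 x ^ S (S n) / w x)
     + 1 * (- 12 * (INR n + 1) * (z61 x ^ S n / w x)
     + (2 * INR n + 1) * (z61 x ^ n / w x))).
  assert (Hf : cont f).
  { unfold f; apply cont_lin, cont_lin; apply cont_z. }
  assert (HK : forall x, is_derive K x (k x)).
  { intro x; unfold K, k, z61, w.
    auto_derive; [trig_side x; apply Rmult_integral_contrapositive; lra|].
    assert (C := one_cos_pos x); assert (Sx := sin_sq x).
    assert (W := sqrt_one_cos_pos x); assert (W2 := sqrt_one_cos_sq x).
    simpl in C, Sx, W, W2 |- *; rewrite !Rmult_1_r in *.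
    revert Sx C W W2; generalize (sqrt (1 + cos x * cos x)) (sin x) (cos x).
    intros v s c Sx C W W2.
    field_simplify_eq; [| split; lra]. ring [Sx W2]. }
  assert (Hg : forall x, dz61 x * K x = z61 x * g x).
  { intro x; unfold K, g, z61, dz61, w.
    assert (C := one_cos_pos x); assert (Sx := sin_sq x).
    assert (W := sqrt_one_cos_pos x).
    revert Sx C W; generalize (sqrt (1 + cos x ^ 2)) (sin x) (cos x).
    intros v s c Sx C W.
    field_simplify_eq; [| split; lra]. ring [Sx]. }
  assert (E : quarter f = 0).
  { rewrite (quarter_derive (fun x => z61 x ^ n * K x) f); auto.
    (* The factor [sin x * cos x] of [K] removes the boundary terms at both ends. *)
    - unfold K; rewrite cos_PI2, sin_0; unfold Rdiv; ring.
    - intro x.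
      replace (f x) with (z61 x ^ n * (INR n * g x + k x)).
      + apply (is_derive_pow_mult z61 K dz61 k g); auto using is_derive_z61.
      + unfold f, g, k; simpl pow; unfold Rdiv; ring. }
  unfold f in E; rewrite !quarter_lin in E; try apply cont_lin; try apply cont_z.
  unfold w in E; fold (M61 n) (M61 (S n)) (M61 (S (S n))) in E; lra.
Qed.

(** In the variable [t = cos x], this integrates the derivative of [t^(k+1) * sqrt (1 - t^4)], which
    vanishes at 0 and 1. *)
Lemma lemn_rec (k : nat) : (INR k + 3) * lemn (4 + k) = (INR k + 1) * lemn k.
Proof.
  pose (w x := sqrt (1 + cos x ^ 2)).
  pose (f x := (INR k + 3) * (cos x ^ (4 + k) / w x) + - (INR k + 1) * (cos x ^ k / w x)).
  assert (Hf : cont f) by (apply cont_lin; apply cont_lemn).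
  assert (E : quarter f = 0).
  { rewrite (quarter_derive (fun x => cos x ^ S k * (sin x * w x)) f); auto.
    - rewrite cos_PI2, sin_0; simpl; ring.
    - intro x; unfold w, f.
      auto_derive; [trig_side x|].
      assert (C := one_cos_pos x); assert (Sx := sin_sq x).
      assert (W := sqrt_one_cos_pos x); assert (W2 := sqrt_one_cos_sq x).
      change (match k with 0%nat => 1 | S _ => INR k + 1 end) with (INR (S k)).
      rewrite S_INR; unfold w. simpl in C, Sx, W, W2 |- *; rewrite !Rmult_1_r in *.
      revert Sx C W W2; generalize (sqrt (1 + cos x * cos x)) (sin x) (cos x).
      intros v s c Sx C W W2.
      field_simplify_eq; [| lra]. ring [Sx W2]. }
  unfold f in E; rewrite quarter_lin in E by apply cont_lemn.
  unfold w in E; fold (lemn (4 + k)) (lemn k) in E; lra.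
Qed.

Lemma wallis_rec (k : nat) : (INR k + 2) * wallis (2 + k) = (INR k + 1) * wallis k.
Proof.
  pose (f x := (INR k + 2) * cos x ^ (2 + k) + - (INR k + 1) * cos x ^ k).
  assert (Hf : cont f) by (apply cont_lin; apply cont_wallis).
  assert (E : quarter f = 0).
  { rewrite (quarter_derive (fun x => cos x ^ S k * sin x) f); auto.
    - rewrite cos_PI2, sin_0; simpl; ring.
    - intro x; unfold f.
      auto_derive; [trivial|].
      assert (Sx := sin_sq x).
      change (match k with 0%nat => 1 | S _ => INR k + 1 end) with (INR (S k)).
      rewrite S_INR. simpl in Sx |- *. ring [Sx]. }
  unfold f in E; rewrite quarter_lin in E by apply cont_wallis.
  fold (wallis (2 + k)) (wallis k) in E; lra.
Qed.

Lemma wallis_0 : wallis 0 = PI / 2.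
Proof.
  unfold wallis, quarter; simpl; rewrite RInt_const; unfold scal; simpl; unfold mult; simpl; ring.
Qed.

Lemma sqrt2_sq : sqrt 2 ^ 2 = 2.
Proof. apply pow2_sqrt; lra. Qed.

Lemma sqrt2_bounds : 1.4 < sqrt 2 < 1.5.
Proof.
  assert (H := sqrt2_sq); assert (P := sqrt_pos 2); split; nra.
Qed.

Lemma H61_0 : H61 0 = PI.
Proof.
  (* Landen's substitution [theta = x + atan (tan x / sqrt 2)], written without singularity. *)
  pose (F x := 2 * x - atan ((sqrt 2 - 1) * sin x * cos x / (sqrt 2 * cos x ^ 2 + sin x ^ 2))).
  assert (R2 := sqrt2_sq); assert (RB := sqrt2_bounds).
  unfold H61; rewrite (quarter_derive F).
  - unfold F; rewrite cos_PI2, sin_0.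
    replace (_ * _ * 0 / _) with 0 by (unfold Rdiv; ring).
    replace (_ * 0 * _ / _) with 0 by (unfold Rdiv; ring).
    rewrite atan_0; lra.
  - intro x; unfold F, h61.
    assert (C := one_cos_pos x); assert (Sx := sin_sq x).
    assert (D : 0 < sqrt 2 * cos x ^ 2 + sin x ^ 2) by nra.
    auto_derive; [simpl in D; lra|].
    simpl in C, Sx, D, R2 |- *; rewrite !Rmult_1_r in *.
    revert Sx C D R2 RB; generalize (sqrt 2) (sin x) (cos x).
    intros r s c Sx C D R2 RB.
    field_simplify_eq; [ ring [Sx R2] |].
    repeat split; try lra; simpl; try nra.
  - apply cont_zh.
Qed.

(* [K] is proportional to [sin theta * cos theta]. *)
Lemma H61_rec (n : nat) :
  (3 + 2 * sqrt 2) * (2 * INR n + 2) * H61 (S n) = (2 * INR n + 1) * H61 n.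
Proof.
  pose (K x := sin x * cos x * ((1 + sqrt 2) * cos x ^ 2 - 1) / (1 + cos x ^ 2)).
  pose (l := 3 + 2 * sqrt 2).
  (* Up to the factor [1 + sqrt 2], [k] is [cos (2 theta)] and [g] is [2 (cos theta)^2], each times
     [h61], the derivative of [theta]. The result is the Wallis reduction for the powers
     [(sin theta)^(2n)]. *)
  pose (k x := h61 x * (1 - 2 * l * z61 x) / (1 + sqrt 2)).
  pose (g x := h61 x * 2 * (1 - l * z61 x) / (1 + sqrt 2)).
  pose (f x := (2 * INR n + 1) * (z61 x ^ n * h61 x) +
               - (l * (2 * INR n + 2)) * (z61 x ^ S n * h61 x)).
  assert (R2 := sqrt2_sq); assert (RB := sqrt2_bounds).
  assert (Hf : cont f) by (apply cont_lin; apply cont_zh).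
  assert (HK : forall x, is_derive K x (k x)).
  { intro x; unfold K, k, z61, h61, l.
    auto_derive; [trig_side x|].
    assert (C := one_cos_pos x); assert (Sx := sin_sq x).
    simpl in C, Sx, R2 |- *; rewrite !Rmult_1_r in *.
    revert Sx C R2 RB; generalize (sqrt 2) (sin x) (cos x).
    intros r s c Sx C R2 RB.
    field_simplify_eq; [| split; lra]. ring [Sx R2]. }
  assert (Hg : forall x, dz61 x * K x = z61 x * g x).
  { intro x; unfold K, g, z61, dz61, h61, l.
    assert (C := one_cos_pos x); assert (Sx := sin_sq x).
    revert Sx C R2 RB; generalize (sqrt 2) (sin x) (cos x).
    intros r s c Sx C R2 RB.
    field_simplify_eq; [| split; lra]. ring [Sx R2]. }
  assert (E : quarter f = 0).
  { rewrite (quarter_derive (fun x => (1 + sqrt 2) * (z61 x ^ n * K x)) f); auto.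
    - unfold K; rewrite cos_PI2, sin_0; unfold Rdiv; ring.
    - intro x.
      replace (f x) with ((1 + sqrt 2) * (z61 x ^ n * (INR n * g x + k x))).
      + apply is_derive_scal, (is_derive_pow_mult z61 K dz61 k g); auto using is_derive_z61.
      + unfold f, g, k; simpl pow; field; lra. }
  unfold f in E; rewrite !quarter_lin in E by apply cont_zh.
  fold (H61 n) (H61 (S n)) in E; unfold l in E; lra.
Qed.

Lemma M61_0 : M61 0 = lemn 0.
Proof. reflexivity. Qed.

(** The three integrands add up to the derivative of [sin x * cos x / sqrt (1 + cos x ^ 2)], which
    vanishes at both ends. *)
Lemma M61_1 : M61 1 = lemn 0 - 2 * lemn 2.
Proof.
  pose (w x := sqrt (1 + cos x ^ 2)).
  pose (f x := 1 * (z61 x ^ 1 / w x) + 1 * (-1 * (cos x ^ 0 / w x) + 2 * (cos x ^ 2 / w x))).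
  assert (Hf : cont f).
  { apply cont_lin; [apply cont_z | apply cont_lin; apply cont_lemn]. }
  assert (E : quarter f = 0).
  { rewrite (quarter_derive (fun x => sin x * cos x / w x) f); auto.
    - rewrite cos_PI2, sin_0; unfold Rdiv; ring.
    - intro x; unfold f, w, z61.
      auto_derive; [trig_side x|].
      assert (C := one_cos_pos x); assert (Sx := sin_sq x).
      assert (W := sqrt_one_cos_pos x); assert (W2 := sqrt_one_cos_sq x).
      simpl in C, Sx, W, W2 |- *; rewrite !Rmult_1_r in *.
      revert Sx C W W2; generalize (sqrt (1 + cos x * cos x)) (sin x) (cos x).
      intros v s c Sx C W W2.
      field_simplify_eq; [| split; lra]. ring [Sx W2]. }
  unfold f in E; rewrite !quarter_lin in E; try apply cont_lin; try apply cont_z; try apply cont_lemn.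
  unfold w in E; fold (M61 1) (lemn 0) (lemn 2) in E; lra.
Qed.

(** * Size of the minimal solution *)

(** The larger root of [z^2 - 6 z + 1], equal to [(1 + sqrt 2)^2]; its inverse is the maximum of
    [z61]. *)
Definition lam : R := 3 + 2 * sqrt 2.
(** The constant [2 * 2^(1/4)] produced by the arithmetic-geometric mean inequality for
    [1 + cos x ^ 2] and [sqrt 2]. *)
Definition kap : R := sqrt (4 * sqrt 2).

Lemma lam_gt_1 : 5 < lam.
Proof. generalize sqrt2_bounds; unfold lam; lra. Qed.

Lemma kap_pos : 0 < kap.
Proof. apply sqrt_lt_R0; generalize sqrt2_bounds; lra. Qed.

Lemma kap_sq : kap ^ 2 = 4 * sqrt 2.
Proof. apply pow2_sqrt; generalize sqrt2_bounds; lra. Qed.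

(* AM-GM for [1 + (cos x)^2] and [sqrt 2]; equality holds where [lam * z61 x = 1]. *)
Lemma kernel_le (x : R) : kap / sqrt (1 + cos x ^ 2) <= h61 x.
Proof.
  assert (C := one_cos_pos x); assert (W := sqrt_one_cos_pos x).
  assert (W2 := sqrt_one_cos_sq x); assert (K := kap_pos); assert (K2 := kap_sq).
  assert (RB := sqrt2_bounds).
  assert (Hh : 0 < h61 x).
  { unfold h61; apply Rplus_lt_0_compat; [lra | apply Rdiv_lt_0_compat; lra]. }
  assert (Hy : 0 < kap / sqrt (1 + cos x ^ 2)) by (apply Rdiv_lt_0_compat; lra).
  apply Rsqr_incr_0; try lra; rewrite !Rsqr_pow2.
  unfold Rdiv; rewrite Rpow_mult_distr, pow_inv, K2, W2; unfold h61.
  apply Rminus_le_0.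
  replace (_ - _) with (((1 + cos x ^ 2 - sqrt 2) / (1 + cos x ^ 2)) ^ 2) by (field; lra).
  apply pow2_ge_0.
Qed.

(** Write [y] for the right side. Since [y <= h61 x], also [y >= y^2 / h61 x = 4 sqrt 2 / (1 + cos x
    ^ 2 + sqrt 2)]. The inequality left is rational in [cos x ^ 2], with a double contact where
    [1 + cos x ^ 2 = sqrt 2]. *)
Lemma kernel_ge (x : R) : lam * z61 x * h61 x <= kap / sqrt (1 + cos x ^ 2).
Proof.
  assert (L := kernel_le x); revert L.
  assert (C := one_cos_pos x); assert (W := sqrt_one_cos_pos x).
  assert (W2 := sqrt_one_cos_sq x); assert (K := kap_pos); assert (K2 := kap_sq).
  assert (RB := sqrt2_bounds); assert (R2 := sqrt2_sq); assert (Sx := sin_sq x).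
  assert (Hy : 0 < kap / sqrt (1 + cos x ^ 2)) by (apply Rdiv_lt_0_compat; lra).
  assert (Hy2 : (kap / sqrt (1 + cos x ^ 2)) ^ 2 = 4 * sqrt 2 / (1 + cos x ^ 2)).
  { unfold Rdiv; rewrite Rpow_mult_distr, pow_inv, K2, W2; reflexivity. }
  revert Hy Hy2; generalize (kap / sqrt (1 + cos x ^ 2)); intros y Hy Hy2 L.
  apply Rle_trans with (4 * sqrt 2 / (1 + cos x ^ 2 + sqrt 2)).
  - unfold lam, z61, h61; rewrite Sx.
    assert (E1 : 1 <= 1 + cos x ^ 2) by (generalize (pow2_ge_0 (cos x)); lra).
    clear - E1 R2 RB; revert E1 R2 RB; generalize (cos x ^ 2) (sqrt 2); intros u r E1 R2 RB.
    apply Rminus_le_0.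
    replace (_ - _) with ((1 + u - r) ^ 2 * ((1 + u + r) ^ 2 * (1 + r) ^ 2 - (1 + u))
                          / ((1 + u) ^ 2 * (1 + u + r))).
    + apply Rmult_le_pos.
      * apply Rmult_le_pos; [apply pow2_ge_0 |].
        assert (Q1 : 1 + u <= (1 + u + r) ^ 2) by nra.
        assert (Q2 : 1 <= (1 + r) ^ 2) by nra.
        generalize (Rmult_le_compat_l ((1 + u + r) ^ 2) _ _ ltac:(lra) Q2); lra.
      * apply Rlt_le, Rinv_0_lt_compat, Rmult_lt_0_compat; nra.
    + field_simplify_eq; [ring [R2] | split; lra].
  - replace (4 * sqrt 2) with (y ^ 2 * (1 + cos x ^ 2)) by (rewrite Hy2; field; lra).
    unfold h61 in L.
    apply Rle_div_l; [lra|].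
    apply (Rmult_le_compat_r (y * (1 + cos x ^ 2))) in L; [|nra].
    replace ((1 + sqrt 2 / (1 + cos x ^ 2)) * (y * (1 + cos x ^ 2)))
      with (y * (1 + cos x ^ 2 + sqrt 2)) in L by (field; lra).
    lra.
Qed.

Lemma z61_ge_0 (x : R) : 0 <= z61 x.
Proof.
  apply Rmult_le_pos; [apply Rmult_le_pos; apply pow2_ge_0|].
  apply Rlt_le, Rinv_0_lt_compat, one_cos_pos.
Qed.

Lemma M61_le (n : nat) : kap * M61 n <= H61 n.
Proof.
  unfold M61, H61; rewrite <- quarter_scal by apply cont_z.
  apply quarter_le; [| apply cont_zh |].
  - intro x; apply (continuous_scal_r (V := R_NormedModule) kap), cont_z.
  - intros x _; assert (L := kernel_le x).
    replace (kap * _) with (z61 x ^ n * (kap / sqrt (1 + cos x ^ 2))) by (unfold Rdiv; ring).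
    apply Rmult_le_compat_l; auto; apply pow_le, z61_ge_0.
Qed.

(** The factor [z61] in [kernel_ge] raises the index of [H61] by one. This costs little: by
    [H61_rec], [lam * H61 (S n) / H61 n] is [(2n+1)/(2n+2)], so the two bounds on [M61 n] agree in
    the limit. *)
Lemma M61_ge (n : nat) : lam * H61 (S n) <= kap * M61 n.
Proof.
  unfold M61, H61; rewrite <- !quarter_scal; try apply cont_z; try apply cont_zh.
  apply quarter_le.
  - intro x; apply (continuous_scal_r (V := R_NormedModule) lam), cont_zh.
  - intro x; apply (continuous_scal_r (V := R_NormedModule) kap), cont_z.
  - intros x _; assert (L := kernel_ge x).
    replace (kap * _) with (z61 x ^ n * (kap / sqrt (1 + cos x ^ 2))) by (unfold Rdiv; ring).
    replace (lam * _) with (z61 x ^ n * (lam * z61 x * h61 x)) by (simpl; ring).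
    apply Rmult_le_compat_l; auto; apply pow_le, z61_ge_0.
Qed.

(** * Comparison with Wallis integrals *)

Lemma wallis_even_rec (n : nat) :
  wallis (2 * S n) = (2 * INR n + 1) / (2 * INR n + 2) * wallis (2 * n).
Proof.
  assert (E := wallis_rec (2 * n)).
  replace (2 * S n)%nat with (2 + 2 * n)%nat by lia.
  rewrite mult_INR in E; change (INR 2) with 2 in E.
  assert (P := pos_INR n).
  apply Rmult_eq_reg_l with (2 * INR n + 2); [|lra].
  rewrite E; field; lra.
Qed.

Lemma wallis_even_pos (n : nat) : 0 < wallis (2 * n).
Proof.
  induction n as [|n IH].
  - simpl; rewrite wallis_0; generalize PI_RGT_0; lra.
  - rewrite wallis_even_rec; apply Rmult_lt_0_compat; auto.
    assert (P := pos_INR n); apply Rdiv_lt_0_compat; lra.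
Qed.

(** After scaling by [lam ^ n] both sides obey the same recurrence. The factor 2 arises because
    [theta] runs over [0, pi] while [x] runs over a quarter period. *)
Lemma H61_wallis (n : nat) : lam ^ n * H61 n = 2 * wallis (2 * n).
Proof.
  induction n as [|n IH].
  - simpl; rewrite wallis_0, H61_0; lra.
  - rewrite wallis_even_rec.
    assert (E := H61_rec n); fold lam in E.
    assert (P := pos_INR n).
    apply Rmult_eq_reg_l with (2 * INR n + 2); [|lra].
    transitivity ((2 * INR n + 1) * (2 * wallis (2 * n))); [|field; lra].
    rewrite <- IH; simpl; transitivity (lam ^ n * ((2 * INR n + 1) * H61 n)); [|ring].
    rewrite <- E; ring.
Qed.

Lemma M61_pos (n : nat) : 0 < M61 n.
Proof.
  assert (L := M61_ge n); assert (K := kap_pos); assert (Q := lam_gt_1).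
  assert (E := H61_wallis (S n)); assert (W := wallis_even_pos (S n)).
  assert (P : 0 < lam ^ S n) by (apply pow_lt; lra).
  assert (0 < H61 (S n)) by nra.
  assert (0 < lam * H61 (S n)) by nra. nra.
Qed.

(** Both bounds become equalities at [cos x ^ 2 = 1], where the mass of a high power of [cos x]
    concentrates; they therefore fix [lemn] to leading order in terms of [wallis]. *)
Lemma lemn_kernel (x : R) : 1 <= sqrt 2 / sqrt (1 + cos x ^ 2) <= 2 - cos x ^ 2.
Proof.
  assert (C := one_cos_pos x); assert (W := sqrt_one_cos_pos x).
  assert (W2 := sqrt_one_cos_sq x); assert (RB := sqrt2_bounds); assert (R2 := sqrt2_sq).
  assert (Sx := sin_sq x); assert (S0 := pow2_ge_0 (sin x)); assert (C0 := pow2_ge_0 (cos x)).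
  assert (Hy : 0 < sqrt 2 / sqrt (1 + cos x ^ 2)) by (apply Rdiv_lt_0_compat; lra).
  assert (Hy2 : (sqrt 2 / sqrt (1 + cos x ^ 2)) ^ 2 = 2 / (1 + cos x ^ 2)).
  { unfold Rdiv; rewrite Rpow_mult_distr, pow_inv, R2, W2; reflexivity. }
  revert Hy Hy2; generalize (sqrt 2 / sqrt (1 + cos x ^ 2)); intros y Hy Hy2.
  revert C C0 Sx Hy2 ; generalize (cos x ^ 2); intros u C C0 Sx Hy2.
  assert (E : y ^ 2 * (1 + u) = 2) by (rewrite Hy2; field; lra).
  split; apply Rsqr_incr_0; try lra; rewrite !Rsqr_pow2.
  - nra.
  - apply Rmult_le_reg_r with (1 + u); [lra|].
    rewrite E. assert (0 <= u * (1 - u)) by nra. nra.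
Qed.

Lemma lemn_bounds (n : nat) :
  wallis (2 * n) <= sqrt 2 * lemn (2 * n) <= 2 * wallis (2 * n) - wallis (2 * S n).
Proof.
  assert (P : forall x, 0 <= cos x ^ (2 * n)) by (intro; rewrite pow_mult; apply pow_le, pow2_ge_0).
  replace (2 * S n)%nat with (2 + 2 * n)%nat by lia.
  set (k := (2 * n)%nat) in *.
  replace (2 * wallis k - wallis (2 + k)) with (2 * wallis k + (-1) * wallis (2 + k)) by ring.
  unfold lemn, wallis.
  rewrite <- quarter_lin by apply cont_wallis.
  rewrite <- quarter_scal by apply cont_lemn.
  split; apply quarter_le; try apply cont_wallis; try (apply cont_lin; apply cont_wallis);
    try (intro x; apply (continuous_scal_r (V := R_NormedModule) (sqrt 2)), cont_lemn);
    intros x _; destruct (lemn_kernel x) as [L1 L2]; specialize (P x);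
    replace (sqrt 2 * _) with (cos x ^ k * (sqrt 2 / sqrt (1 + cos x ^ 2))) by (unfold Rdiv; ring).
  - rewrite <- (Rmult_1_r (cos x ^ k)) at 1; apply Rmult_le_compat_l; auto.
  - replace (2 * cos x ^ k + _) with (cos x ^ k * (2 - cos x ^ 2)) by (simpl; ring).
    apply Rmult_le_compat_l; auto.
Qed.

Lemma lemn_even_pos (n : nat) : 0 < lemn (2 * n).
Proof.
  assert (B := lemn_bounds n); assert (W := wallis_even_pos n).
  assert (RB := sqrt2_bounds). nra.
Qed.

(** By [lemn_rec] the left side does not depend on [n]. This invariant carries the asymptotics of
    [lemn] at infinity back to the constants [lemn 0] and [lemn 2]. *)
Lemma lemn_product (n : nat) :
  (2 * INR n + 1) * lemn (2 * n) * lemn (2 * S n) = lemn 0 * lemn 2.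
Proof.
  induction n as [|n IH]; [simpl; ring|].
  rewrite <- IH.
  assert (E := lemn_rec (2 * n)).
  replace (2 * S (S n))%nat with (4 + 2 * n)%nat by lia.
  rewrite mult_INR in E; change (INR 2) with 2 in E.
  rewrite S_INR.
  transitivity (lemn (2 * S n) * ((2 * INR n + 3) * lemn (4 + 2 * n))); [ring|].
  rewrite E; ring.
Qed.

Lemma is_lim_seq_ratio : is_lim_seq (fun n => (2 * INR n + 1) / (2 * INR n + 2)) 1.
Proof.
  apply is_lim_seq_ext with (fun n => 1 + - / 2 * / (INR (S n))).
  - intro n; rewrite S_INR; assert (P := pos_INR n); field; lra.
  - replace (Finite 1) with (Finite (1 + - / 2 * 0)) by (f_equal; ring).
    apply is_lim_seq_plus'; [apply is_lim_seq_const|].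
    apply (is_lim_seq_scal_l _ _ (Finite 0)).
    apply (is_lim_seq_incr_1 (fun n => / INR n)).
    replace (Finite 0) with (Rbar_inv p_infty) by reflexivity.
    apply is_lim_seq_inv; [apply is_lim_seq_INR | discriminate].
Qed.

(** By [H61_wallis] this is [kap * M61 n / H61 n]. *)
Definition rho (n : nat) : R := kap * M61 n * lam ^ n / (2 * wallis (2 * n)).
Definition sigma (n : nat) : R := sqrt 2 * lemn (2 * n) / wallis (2 * n).

Lemma rho_lim : is_lim_seq rho 1.
Proof.
  apply is_lim_seq_le_le with (fun n => (2 * INR n + 1) / (2 * INR n + 2)) (fun _ => 1).
  - intro n; unfold rho.
    assert (Q := lam_gt_1).
    assert (P : 0 < lam ^ n) by (apply pow_lt; lra).
    assert (W := wallis_even_pos n).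
    assert (L1 := M61_ge n); assert (L2 := M61_le n).
    assert (E1 := H61_wallis n); assert (E2 := H61_wallis (S n)).
    rewrite wallis_even_rec in E2; simpl in E2.
    split.
    + refine (proj1 (Rle_div_r _ _ _ _) _); [lra|].
      replace (_ * (2 * wallis (2 * n))) with (lam * H61 (S n) * lam ^ n).
      * apply Rmult_le_compat_r; lra.
      * replace (lam * H61 (S n) * lam ^ n) with (lam * lam ^ n * H61 (S n)) by ring.
        simpl; rewrite E2; ring.
    + refine (proj2 (Rle_div_l _ _ _ _) _); [lra|].
      rewrite Rmult_1_l, <- E1, (Rmult_comm (lam ^ n)); apply Rmult_le_compat_r; lra.
  - apply is_lim_seq_ratio.
  - apply is_lim_seq_const.
Qed.

Lemma sigma_lim : is_lim_seq sigma 1.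
Proof.
  apply is_lim_seq_le_le with (fun _ => 1) (fun n => 2 - (2 * INR n + 1) / (2 * INR n + 2)).
  - intro n; unfold sigma.
    assert (W := wallis_even_pos n); assert (B := lemn_bounds n).
    rewrite wallis_even_rec in B.
    split; [refine (proj1 (Rle_div_r _ _ _ _) _) | refine (proj2 (Rle_div_l _ _ _ _) _)]; lra.
  - apply is_lim_seq_const.
  - replace (Finite 1) with (Finite (2 - 1)) by (f_equal; ring).
    apply is_lim_seq_minus'; [apply is_lim_seq_const | apply is_lim_seq_ratio].
Qed.

(** In the quotient of two consecutive [rho] by two consecutive [sigma] the Wallis integrals cancel,
    and [lemn_product] evaluates the product of [lemn] that remains. *)
Lemma M61_product_lim :
  is_lim_seq (fun n => lam ^ (2 * n + 1) * (2 * INR n + 1) * M61 (S n) * M61 n)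
    (sqrt 2 * lemn 0 * lemn 2).
Proof.
  set (ab := lemn 0 * lemn 2).
  apply is_lim_seq_ext with (fun n => sqrt 2 * ab * (rho n * rho (S n) / (sigma n * sigma (S n)))).
  - intro n; unfold ab; rewrite <- (lemn_product n); unfold rho, sigma.
    assert (RB := sqrt2_bounds); assert (K2 := kap_sq); assert (R2 := sqrt2_sq).
    assert (W := wallis_even_pos n); assert (W' := wallis_even_pos (S n)).
    assert (J := lemn_even_pos n); assert (J' := lemn_even_pos (S n)).
    replace (2 * n + 1)%nat with (n + S n)%nat by lia; rewrite pow_add.
    revert RB K2 R2 W W' J J'.
    generalize (lemn (2 * n)) (lemn (2 * S n)) (wallis (2 * n)) (wallis (2 * S n))
      (lam ^ n) (lam ^ S n) (M61 n) (M61 (S n)) (sqrt 2) kap (2 * INR n + 1).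
    intros j j' v v' l l' m m' r k N RB K2 R2 W W' J J'.
    field_simplify_eq; [ring [K2 R2] | repeat split; lra].
  - replace (Finite (sqrt 2 * lemn 0 * lemn 2)) with (Finite (sqrt 2 * ab * (1 * 1 / (1 * 1))))
      by (f_equal; unfold ab; field).
    apply (is_lim_seq_scal_l _ (sqrt 2 * ab) (Finite (1 * 1 / (1 * 1)))).
    apply is_lim_seq_div'; [| |lra]; apply is_lim_seq_mult'; auto using rho_lim, sigma_lim.
    + apply (proj1 (is_lim_seq_incr_1 rho 1)), rho_lim.
    + apply (proj1 (is_lim_seq_incr_1 sigma 1)), sigma_lim.
Qed.

(** * The Gamma function *)

Definition euler (s t : R) : R := Rpower t (s - 1) * exp (- t).

(** A relation, so that convergence is part of the assertion; [RInt_gen] is total and denotes a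
    number even for a divergent integral. *)
Definition is_euler (s v : R) : Prop :=
  is_RInt_gen (euler s) (at_right 0) (Rbar_locally p_infty) v.

Lemma euler_pos (s t : R) : 0 < euler s t.
Proof. apply Rmult_lt_0_compat; apply exp_pos. Qed.

Lemma is_derive_Rpower (s t : R) : 0 < t ->
  is_derive (fun t => Rpower t s) t (s * Rpower t (s - 1)).
Proof. intros Ht; apply is_derive_Reals, derivable_pt_lim_power, Ht. Qed.

Lemma continuous_euler (s t : R) : 0 < t -> continuous (euler s) t.
Proof.
  intros Ht; unfold euler; apply (continuous_mult (fun t => Rpower t (s - 1)) (fun t => exp (- t))).
  - apply (ex_derive_continuous (V := R_NormedModule)); eexists; apply is_derive_Rpower, Ht.
  - apply (ex_derive_continuous (V := R_NormedModule)); auto_derive; trivial.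
Qed.

Lemma ex_RInt_pos (f : R -> R) (a b : R) : (forall t, 0 < t -> continuous f t) ->
  0 < a -> 0 < b -> ex_RInt f a b.
Proof.
  intros Hf Ha Hb; apply (ex_RInt_continuous (V := R_CompleteNormedModule)).
  intros t [Ht _]; apply Hf; eapply Rlt_le_trans; [|exact Ht].
  apply Rmin_case; assumption.
Qed.

(* The integrals over [a, b] grow with the interval, so their supremum is the improper integral. *)
Lemma is_RInt_gen_bounded (f : R -> R) (B : R) :
  (forall t, 0 < t -> continuous f t) -> (forall t, 0 < t -> 0 < f t) ->
  (forall a b, 0 < a < 1 -> 1 < b -> RInt f a b <= B) ->
  exists v, 0 < v /\ is_RInt_gen f (at_right 0) (Rbar_locally p_infty) v.
Proof.
  intros Hc Hp HB.
  pose (E v := exists a b, 0 < a < 1 /\ 1 < b /\ v = RInt f a b).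
  assert (Hex : forall a b, 0 < a -> 0 < b -> ex_RInt f a b) by (intros; apply ex_RInt_pos; auto).
  assert (H0 : forall a b, 0 < a <= b -> 0 <= RInt f a b).
  { intros a b Hab; apply RInt_ge_0; try lra.
    - apply Hex; lra.
    - intros; apply Rlt_le, Hp; lra. }
  destruct (completeness E) as [v [Hub Hlub]].
  - exists B; intros w (a & b & Ha & Hb & ->); auto.
  - exists (RInt f (1 / 2) 2), (1 / 2), 2; repeat split; lra.
  - exists v; split.
    + apply Rlt_le_trans with (RInt f (1 / 2) 2).
      * apply RInt_gt_0; [lra | intros; apply Hp; lra | intros; apply Hc; lra].
      * apply Hub; exists (1 / 2), 2; repeat split; lra.
    + intros P [eps HP].
      assert (Hw : exists a b, 0 < a < 1 /\ 1 < b /\ v - eps < RInt f a b).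
      { apply NNPP; intros N.
        assert (v <= v - eps); [|generalize (cond_pos eps); lra].
        apply Hlub; intros w (a & b & Ha & Hb & ->).
        apply Rnot_lt_le; intros L; apply N; exists a, b; auto. }
      destruct Hw as (a0 & b0 & Ha0 & Hb0 & Hw).
      apply (Filter_prod _ _ _ (fun a => 0 < a < a0) (fun b => b0 < b)).
      * assert (Hd : 0 < a0) by lra.
        exists (mkposreal a0 Hd); intros y Hy Hy0; split; auto.
        unfold ball in Hy; simpl in Hy; unfold AbsRing_ball, abs, minus, plus, opp in Hy;
          simpl in Hy.
        apply Rabs_def2 in Hy; lra.
      * exists b0; auto.
      * intros a b Ha Hb; exists (RInt f a b); split.
        -- apply (RInt_correct (V := R_CompleteNormedModule)), Hex; simpl; lra.
        -- apply HP; unfold ball; simpl; unfold AbsRing_ball, abs, minus, plus, opp; simpl.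
           assert (C1 : RInt f a0 b0 <= RInt f a b).
           { rewrite <- (RInt_Chasles f a a0 b); [| apply Hex; lra | apply Hex; lra].
             rewrite <- (RInt_Chasles f a0 b0 b); [| apply Hex; lra | apply Hex; lra].
             unfold plus; simpl.
             generalize (H0 a a0 ltac:(lra)) (H0 b0 b ltac:(lra)); lra. }
           assert (C2 : RInt f a b <= v).
           { apply Hub; exists a, b; repeat split; lra. }
           apply Rabs_def1; generalize (cond_pos eps); lra.
Qed.

(** On (0, 1] the integrand is at most [t^(s-1)], of integral at most [1/s]; on [1, oo) it is at
    most [exp (-t)], because [s <= 1], and this contributes at most 1. *)
Lemma euler_ex_small (s : R) : 0 < s <= 1 -> exists v, 0 < v /\ is_euler s v.
Proof.
  intros Hs; apply is_RInt_gen_bounded with (/ s + 1).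
  - apply continuous_euler.
  - intros; apply euler_pos.
  - intros a b Ha Hb.
    rewrite <- (RInt_Chasles (euler s) a 1 b);
      [| apply ex_RInt_pos; try lra; apply continuous_euler
       | apply ex_RInt_pos; try lra; apply continuous_euler].
    apply Rplus_le_compat.
    + assert (I : is_RInt (fun t => Rpower t (s - 1)) a 1 (Rpower 1 s / s - Rpower a s / s)).
      { apply (is_RInt_derive (V := R_CompleteNormedModule) (fun t => Rpower t s / s)).
        - intros t Ht; rewrite Rmin_left in Ht by lra.
          replace (Rpower t (s - 1)) with (/ s * (s * Rpower t (s - 1))) by (field; lra).
          apply (is_derive_ext (fun t => / s * Rpower t s)); [intros; unfold Rdiv; apply Rmult_comm|].
          apply is_derive_scal, is_derive_Rpower; lra.
        - intros t Ht; rewrite Rmin_left in Ht by lra.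
          apply (ex_derive_continuous (V := R_NormedModule)); eexists; apply is_derive_Rpower; lra. }
      apply Rle_trans with (RInt (fun t => Rpower t (s - 1)) a 1).
      * apply RInt_le; try lra.
        -- apply ex_RInt_pos; try lra; apply continuous_euler.
        -- eexists; apply I.
        -- intros t Ht; unfold euler; rewrite <- (Rmult_1_r (Rpower t (s - 1))) at 2.
           apply Rmult_le_compat_l; [apply Rlt_le, exp_pos|].
           rewrite <- exp_0; apply Rlt_le, exp_increasing; lra.
      * rewrite (is_RInt_unique _ _ _ _ I).
        replace (Rpower 1 s) with 1 by (unfold Rpower; rewrite ln_1, Rmult_0_r, exp_0; reflexivity).
        assert (0 < Rpower a s / s) by (apply Rdiv_lt_0_compat; [apply exp_pos | lra]).
        replace (1 / s) with (/ s) by (field; lra). lra.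
    + assert (I : is_RInt (fun t => exp (- t)) 1 b (- exp (- b) - - exp (- 1))).
      { apply (is_RInt_derive (V := R_CompleteNormedModule) (fun t => - exp (- t))).
        - intros; auto_derive; trivial; ring.
        - intros; apply (ex_derive_continuous (V := R_NormedModule)); auto_derive; trivial. }
      apply Rle_trans with (RInt (fun t => exp (- t)) 1 b).
      * apply RInt_le; try lra.
        -- apply ex_RInt_pos; try lra; apply continuous_euler.
        -- eexists; apply I.
        -- intros t Ht; unfold euler; rewrite <- (Rmult_1_l (exp (- t))) at 2.
           apply Rmult_le_compat_r; [apply Rlt_le, exp_pos|].
           unfold Rpower; apply Rle_trans with (exp 0); [|rewrite exp_0; lra].
           assert (0 < ln t) by (rewrite <- ln_1; apply ln_increasing; lra).
           destruct (Req_dec s 1) as [->|N].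
           ++ replace ((1 - 1) * ln t) with 0 by ring; lra.
           ++ apply Rlt_le, exp_increasing; nra.
      * rewrite (is_RInt_unique _ _ _ _ I).
        assert (exp (-1) < 1) by (rewrite <- exp_0; apply exp_increasing; lra).
        generalize (exp_pos (- b)); lra.
Qed.

Lemma Rpower_exp_at_0 (s : R) : 0 < s ->
  filterlim (fun t => Rpower t s * exp (- t)) (at_right 0) (locally 0).
Proof.
  intros Hs.
  apply (filterlim_ext (fun t => exp (s * ln t - t))).
  { intros t; unfold Rpower; rewrite <- exp_plus; f_equal; ring. }
  apply (filterlim_comp _ _ _ (fun t => s * ln t - t) exp _ (Rbar_locally m_infty)).
  - intros P [M HM].
    assert (L := is_lim_ln_0); specialize (L (fun y => y < M / s)).
    assert (Q : Rbar_locally m_infty (fun y => y < M / s)) by (exists (M / s); auto).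
    specialize (L Q); unfold filtermap in *; unfold at_right, within in *.
    revert L; apply filter_imp.
    intros t Ht H0; specialize (Ht H0); apply HM.
    apply Rlt_div_r in Ht; lra.
  - apply is_lim_exp_m.
Qed.
Lemma Rpower_exp_at_p (s : R) : 0 < s ->
  filterlim (fun t => Rpower t s * exp (- t)) (Rbar_locally p_infty) (locally 0).
Proof.
  intros Hs.
  apply (filterlim_ext (fun t => exp (s * ln t - t))).
  { intros t; unfold Rpower; rewrite <- exp_plus; f_equal; ring. }
  apply (filterlim_comp _ _ _ (fun t => s * ln t - t) exp _ (Rbar_locally m_infty)).
  - intros P [M HM].
    (* Once [ln t / t < 1 / (2 s)], the exponent [s * ln t - t] lies below [- t / 2], hence below
       [M] for [t > -2 M]. *)
    assert (Hd : 0 < / (2 * s)) by (apply Rinv_0_lt_compat; lra).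
    assert (L := is_lim_div_ln_p).
    destruct (L (fun y => y < / (2 * s))) as [N HN].
    { exists (mkposreal _ Hd); intros y Hy.
      unfold ball in Hy; simpl in Hy; unfold AbsRing_ball, abs, minus, plus, opp in Hy;
        simpl in Hy; apply Rabs_def2 in Hy; lra. }
    exists (Rmax (Rmax N 0) (-2 * M)); intros t Ht; apply HM.
    assert (N < t /\ 0 < t /\ -2 * M < t) as (H1 & H2 & H3).
    { repeat split; eapply Rle_lt_trans; try exact Ht.
      - eapply Rle_trans; apply Rmax_l.
      - eapply Rle_trans; [apply Rmax_r | apply Rmax_l].
      - apply Rmax_r. }
    specialize (HN t H1).
    apply (Rmult_lt_compat_l (s * t)) in HN; [|nra].
    replace (s * t * (ln t / t)) with (s * ln t) in HN by (field; lra).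
    replace (s * t * / (2 * s)) with (t / 2) in HN by (field; lra).
    lra.
  - apply is_lim_exp_m.
Qed.

Lemma prod_filter_pos (P : R * R -> Prop) :
  (forall a b, 0 < a < b -> P (a, b)) -> filter_prod (at_right 0) (Rbar_locally p_infty) P.
Proof.
  intros HP; apply (Filter_prod _ _ _ (fun a => 0 < a < 1) (fun b => 1 < b)).
  - exists (mkposreal 1 Rlt_0_1); intros y Hy Hy0; split; auto.
    unfold ball in Hy; simpl in Hy; unfold AbsRing_ball, abs, minus, plus, opp in Hy; simpl in Hy.
    apply Rabs_def2 in Hy; lra.
  - exists 1; auto.
  - intros; apply HP; lra.
Qed.

Lemma is_RInt_gen_pos_ext (f g : R -> R) (v : R) : (forall t, 0 < t -> f t = g t) ->
  is_RInt_gen f (at_right 0) (Rbar_locally p_infty) v ->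
  is_RInt_gen g (at_right 0) (Rbar_locally p_infty) v.
Proof.
  intros E; apply (is_RInt_gen_ext (V := R_NormedModule)).
  apply prod_filter_pos; intros a b Hab t Ht; simpl in Ht; apply E.
  rewrite Rmin_left in Ht; lra.
Qed.

Lemma is_RInt_gen_pos_ge_0 (f : R -> R) (v : R) : (forall t, 0 < t -> 0 <= f t) ->
  is_RInt_gen f (at_right 0) (Rbar_locally p_infty) v -> 0 <= v.
Proof.
  intros Hf Hv; apply Rnot_lt_le; intros N.
  assert (Hd : 0 < - v) by lra.
  assert (F := proj1 (filterlimi_locally _ _) Hv (mkposreal _ Hd)); simpl in F.
  assert (F2 : filter_prod (at_right 0) (Rbar_locally p_infty) (fun ab => 0 < fst ab < snd ab))
    by (apply prod_filter_pos; auto).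
  destruct (filter_ex _ (filter_and _ _ F F2)) as [[a b] [(w & Hw & Hb) Hab]].
  simpl in Hw, Hab.
  assert (0 <= w).
  { apply (is_RInt_ge_0 f a b); auto; [lra | intros; apply Hf; lra]. }
  unfold ball in Hb; simpl in Hb; unfold AbsRing_ball, abs, minus, plus, opp in Hb; simpl in Hb.
  apply Rabs_def2 in Hb; lra.
Qed.

(** Functional equation of Gamma by parts: [t^s * exp (-t)] tends to 0 at both ends, so its
    derivative has integral zero. *)
Lemma is_euler_S (s v : R) : 0 < s -> is_euler s v -> is_euler (s + 1) (s * v).
Proof.
  intros Hs Hv.
  pose (F t := Rpower t s * exp (- t)).
  assert (D : forall t, 0 < t -> is_derive F t (s * euler s t - euler (s + 1) t)).
  { intros t Ht; unfold F, euler; replace (s + 1 - 1) with s by ring.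
    replace (_ - _) with (s * Rpower t (s - 1) * exp (- t) + Rpower t s * (- exp (- t))) by ring.
    apply (is_derive_mult (fun t => Rpower t s) (fun t => exp (- t))).
    - apply is_derive_Rpower, Ht.
    - auto_derive; trivial; ring.
    - intros; apply Rmult_comm. }
  assert (I : is_RInt_gen (Derive F) (at_right 0) (Rbar_locally p_infty) (0 - 0)).
  { apply is_RInt_gen_Derive.
    - apply prod_filter_pos; intros a b Hab t Ht; simpl in Ht; rewrite Rmin_left in Ht by lra.
      eexists; apply D; lra.
    - apply prod_filter_pos; intros a b Hab t Ht; simpl in Ht; rewrite Rmin_left in Ht by lra.
      apply (continuous_ext_loc (Derive F) (fun t => s * euler s t - euler (s + 1) t) t).
      (* The formula for [Derive F] holds for positive arguments only; the ball of radius [t] around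
         [t] stays among them. *)
      + exists (mkposreal t ltac:(lra)); intros y Hy; symmetry; apply is_derive_unique, D.
        unfold ball in Hy; simpl in Hy; unfold AbsRing_ball, abs, minus, plus, opp in Hy;
          simpl in Hy; apply Rabs_def2 in Hy; lra.
      + apply (continuous_minus (V := R_NormedModule) (fun t => s * euler s t)).
        * apply (continuous_scal_r (V := R_NormedModule) s), continuous_euler; lra.
        * apply continuous_euler; lra.
    - apply Rpower_exp_at_0, Hs.
    - apply Rpower_exp_at_p, Hs. }
  unfold is_euler.
  replace (s * v) with (minus (scal s v) (0 - 0)) by (unfold minus, plus, opp, scal; simpl; unfold mult; simpl; ring).
  apply (is_RInt_gen_pos_ext (fun t => minus (scal s (euler s t)) (Derive F t))); [|apply (is_RInt_gen_minus (V := R_NormedModule));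
    [apply (is_RInt_gen_scal (V := R_NormedModule)), Hv | exact I]].
  intros t Ht; rewrite (is_derive_unique _ _ _ (D t Ht)).
  unfold minus, plus, opp, scal; simpl; unfold mult; simpl; ring.
Qed.

(* Nonnegativity of the integral of [euler s t * (sqrt t - B / A)^2]. *)
Lemma euler_log_convex (s A B C : R) : 0 < A ->
  is_euler s A -> is_euler (s + 1 / 2) B -> is_euler (s + 1) C -> B ^ 2 <= A * C.
Proof.
  intros HA IA IB IC; set (x := B / A).
  assert (I : is_RInt_gen (fun t => plus (euler (s + 1) t)
      (plus (scal (-2 * x) (euler (s + 1 / 2) t)) (scal (x ^ 2) (euler s t))))
      (at_right 0) (Rbar_locally p_infty) (plus C (plus (scal (-2 * x) B) (scal (x ^ 2) A)))).
  { apply (is_RInt_gen_plus (V := R_NormedModule)); [exact IC|].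
    apply (is_RInt_gen_plus (V := R_NormedModule));
      apply (is_RInt_gen_scal (V := R_NormedModule)); assumption. }
  apply is_RInt_gen_pos_ge_0 in I.
  - unfold plus, scal in I; simpl in I; unfold mult in I; simpl in I.
    replace (C + _) with ((A * C - B ^ 2) / A) in I by (unfold x; field; lra).
    apply (Rmult_le_compat_r A) in I; [|lra].
    replace ((A * C - B ^ 2) / A * A) with (A * C - B ^ 2) in I by (field; lra). lra.
  - intros t Ht; unfold plus, scal; simpl; unfold mult; simpl; unfold euler.
    (* The exponents are split so that [Rpower t (s - 1)] factors out and a square in
       [Rpower t (1 / 2)] remains. *)
    replace (s + 1 - 1) with (s - 1 + (1 / 2 + 1 / 2)) by field.
    replace (s + 1 / 2 - 1) with (s - 1 + 1 / 2) by field.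
    rewrite !Rpower_plus.
    replace (_ + _) with (Rpower t (s - 1) * exp (- t) * (Rpower t (1 / 2) - x) ^ 2) by ring.
    apply Rmult_le_pos; [apply Rlt_le, euler_pos | apply pow2_ge_0].
Qed.

Lemma is_euler_Gamma (s v : R) : is_euler s v -> Gamma s = v.
Proof. apply (is_RInt_gen_unique (V := R_CompleteNormedModule)). Qed.

Lemma Gamma_small (s : R) : 0 < s <= 1 -> 0 < Gamma s /\ is_euler s (Gamma s).
Proof.
  intros Hs; destruct (euler_ex_small s Hs) as (v & Hv & Iv).
  rewrite (is_euler_Gamma s v Iv); auto.
Qed.

(** * The Gamma quotient as a quotient of lemniscate integrals *)

Lemma lemn_decr (n : nat) : lemn (2 * S n) <= lemn (2 * n).
Proof.
  unfold lemn; apply quarter_le; try apply cont_lemn.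
  intros x _; apply Rmult_le_compat_r.
  - apply Rlt_le, Rinv_0_lt_compat, sqrt_one_cos_pos.
  - rewrite !pow_mult; change ((cos x ^ 2) ^ S n) with (cos x ^ 2 * (cos x ^ 2) ^ n).
    rewrite <- (Rmult_1_l ((cos x ^ 2) ^ n)) at 2.
    apply Rmult_le_compat_r; [apply pow_le, pow2_ge_0|].
    generalize (sin_sq x) (pow2_ge_0 (sin x)); lra.
Qed.

Lemma Gamma_shifts (n : nat) : exists A B,
  0 < A /\ 0 < B /\ is_euler (INR n + 1 / 4) A /\ is_euler (INR n + 3 / 4) B /\
  (A / B) ^ 2 * (4 * INR n + 1) * lemn (2 * S (2 * n)) * lemn 0
  = (Gamma (1 / 4) / Gamma (3 / 4)) ^ 2 * lemn 2 * lemn (2 * (2 * n)).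
Proof.
  induction n as [|n (A & B & HA & HB & IA & IB & E)].
  - destruct (Gamma_small (1 / 4)) as [H1 I1]; [lra|].
    destruct (Gamma_small (3 / 4)) as [H3 I3]; [lra|].
    exists (Gamma (1 / 4)), (Gamma (3 / 4)); simpl INR; rewrite !Rplus_0_l; repeat split; auto.
    simpl; ring.
  - assert (P := pos_INR n).
    exists ((INR n + 1 / 4) * A), ((INR n + 3 / 4) * B); rewrite S_INR; repeat split.
    + apply Rmult_lt_0_compat; lra.
    + apply Rmult_lt_0_compat; lra.
    + replace (INR n + 1 + 1 / 4) with (INR n + 1 / 4 + 1) by ring; apply is_euler_S; auto; lra.
    + replace (INR n + 1 + 3 / 4) with (INR n + 3 / 4 + 1) by ring; apply is_euler_S; auto; lra.
    + assert (R1 := lemn_rec (2 * (2 * n))); assert (R2 := lemn_rec (2 * S (2 * n))).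
      replace (2 * (2 * S n))%nat with (4 + 2 * (2 * n))%nat by lia.
      replace (2 * S (2 * S n))%nat with (4 + 2 * S (2 * n))%nat by lia.
      assert (I2 : forall k, INR (2 * k) = 2 * INR k) by (intros; apply mult_INR).
      rewrite !I2 in R1; rewrite I2, S_INR, I2 in R2.
      apply Rmult_eq_reg_l with (4 * INR n + 3); [|lra].
      transitivity ((Gamma (1 / 4) / Gamma (3 / 4)) ^ 2 * lemn 2 * ((4 * INR n + 1) * lemn (2 * (2 * n)))).
      2: { replace (4 * INR n + 1) with (2 * (2 * INR n) + 1) by ring; rewrite <- R1; ring. }
      transitivity ((4 * INR n + 1) * ((A / B) ^ 2 * (4 * INR n + 1) * lemn (2 * S (2 * n)) * lemn 0)).
      2: { rewrite E; ring. }
      apply Rmult_eq_reg_l with (4 * INR n + 3); [|lra].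
      transitivity (((INR n + 1 / 4) * A / ((INR n + 3 / 4) * B)) ^ 2 * lemn 0 * (4 * INR n + 3) ^ 2 *
         ((4 * INR n + 5) * lemn (4 + 2 * S (2 * n)))); [ring|].
      replace (4 * INR n + 5) with (2 * (2 * INR n + 1) + 3) by ring; rewrite R2.
      field; lra.
Qed.

(** Log-convexity from [n + 1/4] and from [n + 3/4] puts [(A / B)^2 (4n+1)] between [4] and
    [4 (4n+3) / (4n+1)]. Monotonicity of [lemn] puts [lemn (4n+2) / lemn (4n)] between
    [(4n+1) / (4n+3)] and 1. Both ranges enter the invariant of [Gamma_shifts]. *)
Lemma Gamma_ratio_bounds (n : nat) :
  let G := (Gamma (1 / 4) / Gamma (3 / 4)) ^ 2 in
  4 * (4 * INR n + 1) * lemn 0 <= G * lemn 2 * (4 * INR n + 3) /\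
  G * lemn 2 * (4 * INR n + 1) <= 4 * (4 * INR n + 3) * lemn 0.
Proof.
  intros G.
  destruct (Gamma_shifts n) as (A & B & HA & HB & IA & IB & E); fold G in E.
  assert (P := pos_INR n).
  assert (C1 : B ^ 2 <= (INR n + 1 / 4) * A ^ 2).
  { replace ((INR n + 1 / 4) * A ^ 2) with (A * ((INR n + 1 / 4) * A)) by ring.
    apply (euler_log_convex (INR n + 1 / 4)); auto.
    - replace (_ + 1 / 2) with (INR n + 3 / 4) by field; auto.
    - apply is_euler_S; auto; lra. }
  assert (C2 : (INR n + 1 / 4) ^ 2 * A ^ 2 <= (INR n + 3 / 4) * B ^ 2).
  { replace ((INR n + 3 / 4) * B ^ 2) with (B * ((INR n + 3 / 4) * B)) by ring.
    rewrite <- Rpow_mult_distr.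
    apply (euler_log_convex (INR n + 3 / 4)); auto.
    - replace (_ + 1 / 2) with (INR n + 1 / 4 + 1) by field; apply is_euler_S; auto; lra.
    - apply is_euler_S; auto; lra. }
  assert (D1 := lemn_decr (2 * n)).
  assert (D2 := lemn_decr (S (2 * n))).
  assert (R1 := lemn_rec (2 * (2 * n))).
  replace (2 * S (S (2 * n)))%nat with (4 + 2 * (2 * n))%nat in D2 by lia.
  assert (I2 : forall k, INR (2 * k) = 2 * INR k) by (intros; apply mult_INR).
  rewrite !I2 in R1.
  assert (U : 0 < lemn (2 * (2 * n))) by apply lemn_even_pos.
  assert (V : 0 < lemn (2 * S (2 * n))) by apply lemn_even_pos.
  assert (W : 0 < lemn 0) by apply (lemn_even_pos 0).
  assert (T1 : 4 <= (A / B) ^ 2 * (4 * INR n + 1)).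
  { unfold Rdiv; rewrite Rpow_mult_distr, pow_inv.
    apply Rmult_le_reg_r with (B ^ 2); [nra|].
    replace (A ^ 2 * / B ^ 2 * (4 * INR n + 1) * B ^ 2) with (A ^ 2 * (4 * INR n + 1)) by (field; lra).
    lra. }
  assert (T2 : (A / B) ^ 2 * (4 * INR n + 1) * (4 * INR n + 1) <= 4 * (4 * INR n + 3)).
  { unfold Rdiv; rewrite Rpow_mult_distr, pow_inv.
    apply Rmult_le_reg_r with (B ^ 2); [nra|].
    replace (A ^ 2 * / B ^ 2 * (4 * INR n + 1) * (4 * INR n + 1) * B ^ 2)
      with (16 * ((INR n + 1 / 4) ^ 2 * A ^ 2)) by (field; lra).
    lra. }
  revert E T1 T2; generalize ((A / B) ^ 2); intros T E T1 T2.
  set (u := lemn (2 * (2 * n))) in *; set (v := lemn (2 * S (2 * n))) in *.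
  assert (D3 : (4 * INR n + 1) * u <= (4 * INR n + 3) * v).
  { replace (4 * INR n + 1) with (2 * (2 * INR n) + 1) by ring; rewrite <- R1.
    replace (2 * (2 * INR n) + 3) with (4 * INR n + 3) by ring.
    apply Rmult_le_compat_l; lra. }
  set (N := 4 * INR n + 1) in *.
  assert (N1 : 1 <= N) by (unfold N; lra).
  replace (4 * INR n + 3) with (N + 2) in * by (unfold N; ring).
  split.
  - apply Rmult_le_reg_r with u; auto.
    replace (G * lemn 2 * (N + 2) * u) with ((G * lemn 2 * u) * (N + 2)) by ring.
    rewrite <- E.
    apply Rle_trans with (4 * lemn 0 * ((N + 2) * v)).
    + replace (4 * N * lemn 0 * u) with (4 * lemn 0 * (N * u)) by ring.
      apply Rmult_le_compat_l; lra.
    + replace (T * N * v * lemn 0 * (N + 2)) with (T * N * (lemn 0 * ((N + 2) * v))) by ring.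
      rewrite Rmult_assoc; apply Rmult_le_compat_r; auto.
      apply Rlt_le, Rmult_lt_0_compat; auto; apply Rmult_lt_0_compat; lra.
  - apply Rmult_le_reg_r with u; auto.
    replace (G * lemn 2 * N * u) with ((G * lemn 2 * u) * N) by ring.
    rewrite <- E.
    replace (T * N * v * lemn 0 * N) with (T * N * N * (lemn 0 * v)) by ring.
    replace (4 * (N + 2) * lemn 0 * u) with (4 * (N + 2) * (lemn 0 * u)) by ring.
    apply Rmult_le_compat; try lra.
    + apply Rmult_le_pos; lra.
    + apply Rmult_le_pos; lra.
    + apply Rmult_le_compat_l; lra.
Qed.

Lemma Gamma_lemn : (Gamma (1 / 4) / Gamma (3 / 4)) ^ 2 = 4 * lemn 0 / lemn 2.
Proof.
  set (G := _ ^ 2).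
  assert (b := lemn_even_pos 1); simpl Nat.mul in b.
  assert (a := lemn_even_pos 0); simpl Nat.mul in a.
  apply Rmult_eq_reg_r with (lemn 2); [|lra].
  replace (4 * lemn 0 / lemn 2 * lemn 2) with (4 * lemn 0) by (field; lra).
  set (K := G * lemn 2); set (L := 4 * lemn 0).
  assert (H : forall n, (4 * INR n + 1) * (L - K) <= 2 * K /\ (4 * INR n + 1) * (K - L) <= 2 * L).
  { intros n; destruct (Gamma_ratio_bounds n) as [B1 B2]; fold G in B1, B2; unfold K, L; lra. }
  (* If linearly growing multiples of [x] stay bounded above, then [x <= 0]; applied to [L - K] and
     to [K - L] this forces equality. *)
  assert (Q : forall x y, (forall n, (4 * INR n + 1) * x <= y) -> x <= 0).
  { intros x y Hxy; apply Rnot_lt_le; intros Hx.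
    destruct (INR_unbounded (y / x)) as [n Hn].
    specialize (Hxy n); apply (Rmult_lt_compat_r x) in Hn; auto.
    replace (y / x * x) with y in Hn by (field; lra).
    assert (0 <= INR n * x) by (apply Rmult_le_pos; [apply pos_INR | lra]). lra. }
  assert (H1 : L - K <= 0) by (apply (Q _ (2 * K)); intros; apply H).
  assert (H2 : K - L <= 0) by (apply (Q _ (2 * L)); intros; apply H).
  lra.
Qed.

(** * Convergents *)

(** The limit is the fixed point of [x = a x + l]; the distance to it shrinks by [a] at each step,
    up to the vanishing error [r n - l]. *)
Lemma is_lim_seq_affine (X r : nat -> R) (a l : R) : 0 <= a < 1 ->
  (forall n, X (S n) = a * X n + r n) -> is_lim_seq r l -> is_lim_seq X (l / (1 - a)).
Proof.
  intros Ha HX Hr.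
  set (L := l / (1 - a)).
  assert (HL : L = a * L + l) by (unfold L; field; lra).
  apply is_lim_seq_spec; intros eps; simpl.
  (* Errors below [eps / 2 * (1 - a)] accumulate, through the geometric series of ratio [a], to at
     most [eps / 2]. *)
  assert (Hd : 0 < eps / 2 * (1 - a)).
  { generalize (cond_pos eps); intros; apply Rmult_lt_0_compat; lra. }
  destruct (proj2 (is_lim_seq_spec r l) Hr (mkposreal _ Hd)) as [N HN]; simpl in HN.
  assert (B : forall k, Rabs (X (N + k)%nat - L) <= a ^ k * Rabs (X N - L) + eps / 2).
  { induction k as [|k IH].
    - rewrite Nat.add_0_r; simpl; generalize (cond_pos eps); lra.
    - rewrite Nat.add_succ_r, HX.
      replace (a * X (N + k)%nat + r (N + k)%nat - L)
        with (a * (X (N + k)%nat - L) + (r (N + k)%nat - l)) by (rewrite HL at 2; ring).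
      eapply Rle_trans; [apply Rabs_triang|].
      rewrite Rabs_mult, (Rabs_pos_eq a) by lra.
      assert (Hk := HN (N + k)%nat ltac:(lia)).
      apply (Rmult_le_compat_l a) in IH; [|lra].
      simpl; lra. }
  assert (Lim : is_lim_seq (fun k => a ^ k * Rabs (X N - L)) 0).
  { replace (Finite 0) with (Finite (0 * Rabs (X N - L))) by (f_equal; ring).
    apply (is_lim_seq_scal_r _ _ (Finite 0)), is_lim_seq_geom; rewrite Rabs_pos_eq; lra. }
  destruct (proj2 (is_lim_seq_spec _ 0) Lim (pos_div_2 eps)) as [N' HN']; simpl in HN'.
  exists (N + N')%nat; intros n Hn.
  replace n with (N + (n - N))%nat by lia.
  eapply Rle_lt_trans; [apply B|].
  specialize (HN' (n - N)%nat ltac:(lia)); rewrite Rminus_0_r in HN'.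
  apply Rabs_def2 in HN'; lra.
Qed.

Lemma cf_p_SS (a b : nat -> R) (n : nat) :
  cf_p a b (S (S n)) = a (S (S n)) * cf_p a b (S n) + b (S n) * cf_p a b n.
Proof. unfold cf_p; simpl; destruct (cf_pq a b n) as [[[p p'] q] q']; reflexivity. Qed.

Lemma cf_q_SS (a b : nat -> R) (n : nat) :
  cf_q a b (S (S n)) = a (S (S n)) * cf_q a b (S n) + b (S n) * cf_q a b n.
Proof. unfold cf_q; simpl; destruct (cf_pq a b n) as [[[p p'] q] q']; reflexivity. Qed.

(** The double factorial [(2n+1)!!]. *)
Fixpoint odd_fact (n : nat) : R :=
  match n with
  | O => 1
  | S m => (2 * INR (S m) + 1) * odd_fact m
  end.

Lemma odd_fact_pos (n : nat) : 0 < odd_fact n.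
Proof.
  induction n as [|n IH]; [simpl; lra|].
  apply Rmult_lt_0_compat; auto; generalize (pos_INR (S n)); lra.
Qed.

Lemma a61_SS (n : nat) : a61 (S (S n)) = 12 * INR (S (S n)).
Proof. reflexivity. Qed.
Lemma b61_S (n : nat) : b61 (S n) = - (2 * INR (S n) + 1) ^ 2.
Proof. reflexivity. Qed.

(** Each step multiplies the Casoratian by [- b61 (S n)], the square of the new factor of
    [odd_fact]. *)
Lemma cf61_casoratian (n : nat) :
  cf_p a61 b61 (S n) * cf_q a61 b61 n - cf_p a61 b61 n * cf_q a61 b61 (S n)
  = 8 * odd_fact n ^ 2.
Proof.
  induction n as [|n IH].
  - unfold cf_p, cf_q; simpl; ring.
  - rewrite cf_p_SS, cf_q_SS, b61_S.
    change (odd_fact (S n)) with ((2 * INR (S n) + 1) * odd_fact n).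
    transitivity ((2 * INR (S n) + 1) ^ 2 *
      (cf_p a61 b61 (S n) * cf_q a61 b61 n - cf_p a61 b61 n * cf_q a61 b61 (S n))); [ring|].
    rewrite IH; ring.
Qed.

(** Both sides obey the recurrence of the convergents, by [M61_rec] on the right, and agree at the
    first two indices. The hypothesis of the induction therefore carries two consecutive indices. *)
Lemma cf61_remainder (n : nat) :
  4 * lemn 0 / lemn 2 * cf_q a61 b61 n - cf_p a61 b61 n
  = odd_fact n * (4 / lemn 2 * M61 (S n)).
Proof.
  assert (b := lemn_even_pos 1); simpl Nat.mul in b.
  assert (H : forall n,
    (4 * lemn 0 / lemn 2 * cf_q a61 b61 n - cf_p a61 b61 n
      = odd_fact n * (4 / lemn 2 * M61 (S n))) /\
    (4 * lemn 0 / lemn 2 * cf_q a61 b61 (S n) - cf_p a61 b61 (S n)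
      = odd_fact (S n) * (4 / lemn 2 * M61 (S (S n))))).
  2: apply H.
  clear n; induction n as [|n [IH1 IH2]].
  (* The convergents [8/1] and [96/11] match [M61 1 = lemn 0 - 2 lemn 2] and
     [3 M61 2 = 11 lemn 0 - 24 lemn 2]. *)
  - split.
    + rewrite M61_1; unfold cf_p, cf_q; simpl; field; lra.
    + assert (E := M61_rec 0); simpl INR in E; rewrite M61_1, M61_0 in E.
      replace (M61 2) with ((11 * lemn 0 - 24 * lemn 2) / 3) by lra.
      unfold cf_p, cf_q; simpl; field; lra.
  - split; [exact IH2|].
    rewrite cf_p_SS, cf_q_SS, b61_S, a61_SS.
    transitivity (12 * INR (S (S n)) * (4 * lemn 0 / lemn 2 * cf_q a61 b61 (S n) - cf_p a61 b61 (S n))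
      - (2 * INR (S n) + 1) ^ 2 * (4 * lemn 0 / lemn 2 * cf_q a61 b61 n - cf_p a61 b61 n)); [ring|].
    rewrite IH1, IH2.
    assert (E := M61_rec (S n)).
    change (odd_fact (S (S n))) with ((2 * INR (S (S n)) + 1) * ((2 * INR (S n) + 1) * odd_fact n)).
    change (odd_fact (S n)) with ((2 * INR (S n) + 1) * odd_fact n).
    replace (2 * INR (S (S n)) + 1) with (2 * INR (S n) + 3) by (rewrite (S_INR (S n)); ring).
    transitivity ((2 * INR (S n) + 1) * odd_fact n * (4 / lemn 2) * ((2 * INR (S n) + 3) * M61 (S (S (S n)))));
      [|ring].
    rewrite E, (S_INR (S n)); ring.
Qed.

Lemma lam_pow (n : nat) : (1 + sqrt 2) ^ (4 * n + 4) = lam ^ (2 * n + 2).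
Proof.
  replace (4 * n + 4)%nat with (2 * (2 * n + 2))%nat by lia.
  rewrite pow_mult; f_equal; assert (R2 := sqrt2_sq); unfold lam.
  replace ((1 + sqrt 2) ^ 2) with (1 + 2 * sqrt 2 + sqrt 2 ^ 2) by ring; lra.
Qed.

Theorem theorem6p1 :
  let G := (Gamma (1/4) / Gamma (3/4)) ^ 2 in
  is_lim_seq (fun n => cf_p a61 b61 n / cf_q a61 b61 n) G /\
  is_lim_seq
    (fun n => (G - cf_p a61 b61 n / cf_q a61 b61 n)
              / (4 * G / (1 + sqrt 2) ^ (4 * n + 4)))
    1.
Proof.
  intros G.
  assert (HG : G = 4 * lemn 0 / lemn 2) by apply Gamma_lemn.
  assert (b := lemn_even_pos 1); simpl Nat.mul in b.
  assert (a := lemn_even_pos 0); simpl Nat.mul in a.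
  assert (Q := lam_gt_1); assert (R2 := sqrt2_sq); assert (RB := sqrt2_bounds).
  assert (GP : 0 < G) by (rewrite HG; apply Rdiv_lt_0_compat; lra).
  (* [m] is the minimal solution of the recurrence, [X n] its inverse ratio to [q n], rescaled. *)
  pose (m n := 4 / lemn 2 * M61 (S n)).
  assert (mP : forall n, 0 < m n).
  { intros n; apply Rmult_lt_0_compat; [apply Rdiv_lt_0_compat; lra | apply M61_pos]. }
  assert (Hm : forall n, G * cf_q a61 b61 n - cf_p a61 b61 n = odd_fact n * m n).
  { intros n; rewrite HG; apply cf61_remainder. }
  pose (X n := cf_q a61 b61 n / (odd_fact n * m n) / lam ^ (2 * n)).
  pose (r n := 8 / ((2 * INR n + 3) * m n * m (S n) * lam ^ (2 * n + 2))).
  assert (lP : forall k, 0 < lam ^ k) by (intros; apply pow_lt; lra).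
  assert (HX : forall n, X (S n) = / lam ^ 2 * X n + r n).
  { intros n; unfold X, r.
    assert (C := cf61_casoratian n).
    assert (E0 := Hm n); assert (E1 := Hm (S n)).
    assert (O := odd_fact_pos n); assert (P0 := mP n); assert (P1 := mP (S n)).
    assert (EO : odd_fact (S n) = (2 * INR n + 3) * odd_fact n).
    { simpl odd_fact; change (match n with 0%nat => 1 | S _ => INR n + 1 end) with (INR (S n)).
      rewrite S_INR; ring. }
    rewrite EO in E1 |- *; assert (IP := pos_INR n).
    replace (2 * S n)%nat with (2 * n + 2)%nat by lia; rewrite pow_add.
    assert (L1 := lP (2 * n)%nat).
    (* Substituting [p = G q - odd_fact * m] in the Casoratian cancels the terms in [G]. Division by
       the two remainders then gives the increment of [q n / (odd_fact n * m n)]. *)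
    assert (C' : cf_q a61 b61 (S n) * (odd_fact n * m n)
       - cf_q a61 b61 n * ((2 * INR n + 3) * odd_fact n * m (S n)) = 8 * odd_fact n ^ 2).
    { rewrite <- E0, <- E1, <- C; ring. }
    assert (L2 : lam <> 0) by lra.
    apply Rmult_eq_reg_r with (odd_fact n); [|lra].
    replace (cf_q a61 b61 (S n))
      with ((8 * odd_fact n ^ 2 + cf_q a61 b61 n * ((2 * INR n + 3) * odd_fact n * m (S n)))
            / (odd_fact n * m n)) by (rewrite <- C'; field; lra).
    field; repeat split; lra. }
  (* [M61_product_lim] is used at index [S n]; its exponent [2n+3] is one more than that in [r],
     whence the division by [lam]. *)
  assert (Hr : is_lim_seq r (8 / (16 / lemn 2 ^ 2 * (sqrt 2 * lemn 0 * lemn 2) / lam))).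
  { apply is_lim_seq_ext with (fun n => 8 / (16 / lemn 2 ^ 2 *
      (lam ^ (2 * S n + 1) * (2 * INR (S n) + 1) * M61 (S (S n)) * M61 (S n)) / lam)).
    - intros n; unfold r, m; rewrite S_INR.
      replace (2 * S n + 1)%nat with (S (2 * n + 2)) by lia.
      change (lam ^ S (2 * n + 2)) with (lam * lam ^ (2 * n + 2)).
      assert (L1 := lP (2 * n + 2)%nat); assert (IP := pos_INR n).
      assert (P0 := M61_pos (S n)); assert (P1 := M61_pos (S (S n))).
      field; repeat split; lra.
    - assert (NZ : 0 < sqrt 2 * lemn 0 * lemn 2).
      { apply Rmult_lt_0_compat; auto; apply Rmult_lt_0_compat; lra. }
      apply is_lim_seq_div'; [apply is_lim_seq_const | |].
      + apply is_lim_seq_div'; [| apply is_lim_seq_const | lra].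
        apply is_lim_seq_mult'; [apply is_lim_seq_const|].
        apply (is_lim_seq_incr_1
          (fun n => lam ^ (2 * n + 1) * (2 * INR n + 1) * M61 (S n) * M61 n)).
        apply M61_product_lim.
      + apply Rgt_not_eq, Rdiv_lt_0_compat; [|lra].
        apply Rmult_lt_0_compat; auto; apply Rdiv_lt_0_compat; [lra | apply pow_lt, b]. }
  assert (il : 0 < / lam ^ 2 < 1).
  { split; [apply Rinv_0_lt_compat, lP|].
    rewrite <- Rinv_1; apply Rinv_lt_contravar; nra. }
  assert (LX : is_lim_seq X (lam ^ 2 / (4 * G))).
  (* The simplification rests on [lam - 1 / lam = 4 sqrt 2] and [G = 4 lemn 0 / lemn 2]. *)
  { replace (lam ^ 2 / (4 * G)) with
      (8 / (16 / lemn 2 ^ 2 * (sqrt 2 * lemn 0 * lemn 2) / lam) / (1 - / lam ^ 2)).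
    - apply (is_lim_seq_affine X r); auto; lra.
    - rewrite HG.
      assert (1 < lam ^ 2) by nra.
      field_simplify_eq; [| repeat split; lra].
      unfold lam; ring [R2]. }
  (* Positivity comes from [X], whose affine recurrence has positive coefficients, whereas that of
     [q] contains negative ones. *)
  assert (qP : forall n, 0 < cf_q a61 b61 n).
  { assert (XP : forall n, 0 < X n).
    { induction n as [|n IH].
      - unfold X, cf_q; simpl; specialize (mP 0%nat).
        apply Rdiv_lt_0_compat; [apply Rdiv_lt_0_compat|]; lra.
      - rewrite HX; apply Rplus_lt_0_compat; [apply Rmult_lt_0_compat; lra|].
        assert (IP := pos_INR n).
        apply Rdiv_lt_0_compat; [lra|].
        apply Rmult_lt_0_compat; [|apply lP]; apply Rmult_lt_0_compat; [|apply mP].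
        apply Rmult_lt_0_compat; [lra | apply mP]. }
    intros n; specialize (XP n); unfold X in XP.
    assert (O := odd_fact_pos n); assert (P0 := mP n); assert (L1 := lP (2 * n)%nat).
    replace (cf_q a61 b61 n) with
      (cf_q a61 b61 n / (odd_fact n * m n) / lam ^ (2 * n) * (lam ^ (2 * n) * (odd_fact n * m n)))
      by (field; repeat split; lra).
    apply Rmult_lt_0_compat; [exact XP|]; apply Rmult_lt_0_compat; [apply lP|].
    apply Rmult_lt_0_compat; assumption. }
  assert (Main : is_lim_seq
    (fun n => (G - cf_p a61 b61 n / cf_q a61 b61 n)
              / (4 * G / (1 + sqrt 2) ^ (4 * n + 4))) 1).
  (* [X n] is the inverse of [lam ^ (2n) * (G - p n / q n)]; the extra [lam ^ 2] comes from the
     exponent [4n+4]. *)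
  { apply is_lim_seq_ext with (fun n => lam ^ 2 / (4 * G) / X n).
    - intros n; rewrite lam_pow, pow_add; unfold X.
      assert (O := odd_fact_pos n); assert (P0 := mP n); assert (L1 := lP (2 * n)%nat).
      specialize (qP n).
      replace (cf_p a61 b61 n) with (G * cf_q a61 b61 n - odd_fact n * m n) by (rewrite <- Hm; ring).
      field; repeat split; lra.
    - assert (NZ : 0 < lam ^ 2 / (4 * G)) by (apply Rdiv_lt_0_compat; [apply lP | lra]).
      replace (Finite 1) with (Finite (lam ^ 2 / (4 * G) / (lam ^ 2 / (4 * G))))
        by (f_equal; field; split; lra).
      apply is_lim_seq_div'; [apply is_lim_seq_const | exact LX | lra]. }
  split; [|exact Main].
  (* Convergence follows from the asymptotics: the error is a sequence tending to 1 times this one,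
     which tends to 0. *)
  assert (Z : is_lim_seq (fun n => 4 * G / (1 + sqrt 2) ^ (4 * n + 4)) 0).
  { apply is_lim_seq_ext with (fun n => 4 * G / lam ^ 2 * (/ lam ^ 2) ^ n).
    - intros n; rewrite lam_pow, pow_add, pow_inv, <- pow_mult.
      assert (L1 := lP (2 * n)%nat); field; split; lra.
    - replace (Finite 0) with (Finite (4 * G / lam ^ 2 * 0)) by (f_equal; ring).
      apply (is_lim_seq_scal_l _ _ (Finite 0)), is_lim_seq_geom.
      rewrite Rabs_pos_eq; lra. }
  apply is_lim_seq_ext with (fun n => G - (G - cf_p a61 b61 n / cf_q a61 b61 n)
              / (4 * G / (1 + sqrt 2) ^ (4 * n + 4)) * (4 * G / (1 + sqrt 2) ^ (4 * n + 4))).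
  - intros n; rewrite lam_pow; specialize (qP n); assert (L1 := lP (2 * n + 2)%nat).
    field; repeat split; lra.
  - replace (Finite G) with (Finite (G - 1 * 0)) by (f_equal; ring).
    apply is_lim_seq_minus'; [apply is_lim_seq_const|].
    apply is_lim_seq_mult'; assumption.
Qed.
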